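(* Let $G$ be a connected edge-transitive graph that is not isomorphic to a star. Then every path in $G$ of length at most $3$ closes to a cycle. Moreover, for every integer $\ell\geq 4$, there exist infinitely many connected edge-transitive graphs each containing a path of length $\ell$ that does not close to a cycle.
   Context: All graphs are finite, simple and undirected, and graphs are considered up to isomorphism. A star is a complete bipartite graph $K_{1,n}$ for some $n\ge 0$. A graph is edge-transitive if for every two edges $e,f$ there is an automorphism mapping $e$ to $f$ (edges mapped via $\{x,y\}\mapsto\{\phi(x),\phi(y)\}$). A path of length $\ell$ in $G$ is a sequence $(x_0,\dots,x_\ell)$ of pairwise distinct vertices with $x_i x_{i+1}\in E(G)$ for $0\le i\le \ell-1$ (length $0$ means a single vertex). A cycle is a sequence $(x_0,\dots,x_{\ell-1},x_\ell=x_0)$ with $\ell\ge 3$, $x_0,\dots,x_{\ell-1}$ pairwise distinct and consecutive vertices adjacent. Paths and cycles are identified with the subgraphs formed by their vertices and edges. A path $P$ closes to a cycle if there is a cycle $C$ in $G$ with $P$ a subgraph of $C$. *)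

(* Defs.v *)
From mathcomp Require Import all_boot.

Set Implicit Arguments.
Unset Strict Implicit.
Unset Printing Implicit Defensive.

Record sgraph := SGraph {
  vertex :> finType;
  adj : rel vertex;
  adj_sym : symmetric adj;
  adj_irr : irreflexive adj }.

Definition edges (G : sgraph) : {set {set G}} :=
  [set [set x; y] | x in G, y in G & adj x y].

Definition graph_iso (G H : sgraph) (f : G -> H) : Prop :=
  bijective f /\ forall x y : G, adj (f x) (f y) = adj x y.

Definition isomorphic (G H : sgraph) : Prop :=
  exists f : G -> H, graph_iso f.

Definition connected (G : sgraph) : Prop :=
  0 < #|G| /\ forall x y : G, connect (@adj G) x y.

Definition edge_transitive (G : sgraph) : Prop :=
  forall e f : {set G}, e \in edges G -> f \in edges G ->
    exists2 phi : G -> G, graph_iso phi & phi @: e = f.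

Section CompleteBipartite.
Variables m n : nat.

Definition bip_adj : rel ('I_m + 'I_n) := fun u v =>
  match u, v with
  | inl _, inr _ | inr _, inl _ => true
  | _, _ => false
  end.

Lemma bip_adj_sym : symmetric bip_adj.
Proof. by case=> ? [?|?]. Qed.

Lemma bip_adj_irr : irreflexive bip_adj.
Proof. by case. Qed.

Definition complete_bipartite : sgraph := SGraph bip_adj_sym bip_adj_irr.
End CompleteBipartite.

Definition is_star (G : sgraph) : Prop :=
  exists n : nat, isomorphic G (complete_bipartite 1 n).

Section PathsAndCycles.
Variable G : sgraph.
Implicit Types p c : seq G.

Definition is_path_of_length (l : nat) p : Prop :=
  [/\ size p = l.+1, uniq p & sorted (@adj G) p].

(* The cycle (x_0, ..., x_{l-1}, x_l = x_0) is represented by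
   [:: x_0; ...; x_{l-1}], without repeating the base point. *)
Definition is_cycle c : Prop :=
  [/\ 3 <= size c, uniq c & cycle (@adj G) c].

Definition path_edges p : seq {set G} :=
  if p is x :: p' then pairmap (fun y z => [set y; z]) x p' else [::].

Definition cycle_edges c : seq {set G} :=
  if c is x :: c' then path_edges (x :: rcons c' x) else [::].

Definition closes_to_cycle p : Prop :=
  exists c, [/\ is_cycle c, {subset p <= c}
              & {subset path_edges p <= cycle_edges c}].
End PathsAndCycles.

(* Infinitely many isomorphism classes of graphs satisfy P. *)
Definition infinitely_many_graphs (P : sgraph -> Prop) : Prop :=
  exists F : nat -> sgraph,
    (forall i, P (F i)) /\ (forall i j, i <> j -> ~ isomorphic (F i) (F j)).

(* Main.v *)
Require Import Defs.
From mathcomp Require Import all_boot perm zify.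

Set Implicit Arguments.
Unset Strict Implicit.
Unset Printing Implicit Defensive.

(**
  For the first part, a leaf would by edge-transitivity make every edge
  pendant and hence [G] a star, so all degrees are at least 2.  Deleting the
  two ends of an edge then leaves [G] connected: otherwise take an edge [xy]
  and a component [C] of [G - {x, y}] of minimal size.  If [C] contains an
  edge [uv], the part of [G] outside [C] stays connected in [G - {u, v}], so
  [G - {u, v}] has a component strictly inside [C].  If [C] is a single vertex
  [w], then [w] has degree 2, so [xy] has an end of degree 2, say [x]; then
  [wxy] is a triangle attached to the rest at [y] only, and [G - {x, w}] is
  connected.  Hence a path [w x y z] closes through [G - {x, y}], and shorter
  paths extend to one of length 3 or lie on a triangle.

  For the second part, double every edge of a complete graph and subdivide all
  edges once.  A path that starts at one of the two midpoints between the
  vertices 0 and 1 and continues through 0, the other midpoint, 1, and a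
  midpoint between 1 and 2 does not close: the cycle would have to join its
  first vertex to 1, which already has two neighbours on the path.
*)


(** * Preliminaries on pairs, connectivity and isomorphisms *)

Lemma set2_eq (T : finType) (x y x' y' : T) :
  [set x; y] = [set x'; y'] -> (x = x' /\ y = y') \/ (x = y' /\ y = x').
Proof.
move=> /setP e; move: (e x) (e y) (e x') (e y').
rewrite !inE !eqxx ?orbT /= => /esym/orP[]/eqP-> /esym/orP[]/eqP->;
  rewrite ?eqxx ?orbT ?orbb /=.
- by move=> _ /eqP ->; left.
- by left.
- by right.
- by move=> /eqP ->; left.
Qed.

Lemma connect_homo (T U : finType) (r : rel T) (s : rel U) (f : T -> U) a b :
  {homo f : x y / r x y >-> s x y} -> connect r a b -> connect s (f a) (f b).
Proof.
move=> fh /connectP[p pth ->]; apply/connectP; exists (map f p).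
  by rewrite (homo_path fh).
by rewrite last_map.
Qed.

Lemma graph_iso_inv (G H : sgraph) (f : G -> H) : graph_iso f ->
  exists2 g : H -> G, graph_iso g & cancel f g /\ cancel g f.
Proof.
move=> [[g fK gK] fadj]; exists g => //; split; first by exists f.
by move=> x y; rewrite -fadj !gK.
Qed.

(** * Short paths in edge-transitive graphs *)

Section EdgeTransitive.
Variable G : sgraph.
Hypothesis connG : connected G.
Hypothesis etG : edge_transitive G.
Implicit Types (x y z t u v w a b c : G) (p : seq G).

Lemma mem_edges x y : adj x y -> [set x; y] \in edges G.
Proof. by move=> xy; apply/imset2P; exists x y; rewrite ?inE. Qed.

Lemma edge_transitive_adj x y x' y' : adj x y -> adj x' y' ->
  exists2 phi : G -> G, graph_iso phi &
    (phi x = x' /\ phi y = y') \/ (phi x = y' /\ phi y = x').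
Proof.
move=> xy xy'; have [phi iso e] := etG (mem_edges xy) (mem_edges xy').
by exists phi => //; apply: set2_eq; rewrite -e imsetU !imset_set1.
Qed.

Definition iso_invariant (P : G -> G -> Prop) : Prop :=
  forall (phi : G -> G) x y, graph_iso phi -> P x y -> P (phi x) (phi y).

(** An automorphism may carry the edge over reversed, hence the two alternatives. *)
Lemma iso_invariant_edges (P : G -> G -> Prop) x y x' y' : iso_invariant P ->
  adj x y -> P x y -> adj x' y' -> P x' y' \/ P y' x'.
Proof.
move=> inv xy Pxy xy'.
have [phi iso [[<- <-]|[<- <-]]] := edge_transitive_adj xy xy'.
  by left; apply: inv.
by right; apply: inv.
Qed.

Lemma connected_ind (P : G -> Prop) x :
  P x -> (forall u v, P u -> adj u v -> P v) -> forall y, P y.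
Proof.
move=> Px cl y; have /connectP[p pth ->] := connG.2 x y.
by elim: p x Px pth => //= z p IH x Px /andP[xz]; apply: IH; apply: cl xz.
Qed.

(** An isolated [x] also qualifies, for every [y]. *)
Definition leaf_at x y : Prop := forall z, adj x z -> z = y.

Definition degree_le2 x : Prop :=
  exists a b, forall z, adj x z -> z = a \/ z = b.

(** Adjacency in [G - {x, y}], kept as a relation on all of [G] so that no induced subgraph has to
    be built. *)
Definition avoid x y : rel G :=
  [rel a b | [&& adj a b, a \notin [:: x; y] & b \notin [:: x; y]]].

Definition separating x y : Prop :=
  exists a b, [/\ a \notin [:: x; y], b \notin [:: x; y]
                & ~~ connect (avoid x y) a b].

Lemma avoid_sym x y : symmetric (avoid x y).
Proof.
by move=> a b; rewrite /avoid /= adj_sym; case: adj => //=; rewrite andbC.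
Qed.

Lemma avoidC x y : avoid x y =2 avoid y x.
Proof.
by move=> a b; rewrite /avoid /= !inE (orbC (a == x)) (orbC (b == x)).
Qed.

Lemma leaf_at_iso : iso_invariant leaf_at.
Proof.
move=> phi x y iso lf z; have [psi [_ adjpsi] [phiK psiK]] := graph_iso_inv iso.
by rewrite -adjpsi phiK => /lf <-; rewrite psiK.
Qed.

Lemma degree_le2_iso : iso_invariant (fun x _ => degree_le2 x).
Proof.
move=> phi x y iso [a [b ab]].
have [psi [_ adjpsi] [phiK psiK]] := graph_iso_inv iso.
exists (phi a), (phi b) => z.
by rewrite -adjpsi phiK => /ab [] <-; rewrite psiK; [left|right].
Qed.

Lemma separating_iso : iso_invariant separating.
Proof.
move=> phi x y iso [a [b [ax bx nab]]].
have [psi [_ adjpsi] [phiK psiK]] := graph_iso_inv iso.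
have inj := can_inj phiK.
have notinE c : (phi c \notin [:: phi x; phi y]) = (c \notin [:: x; y]).
  by rewrite !inE !(inj_eq inj).
exists (phi a), (phi b); rewrite !notinE; split=> //.
apply: contra nab => /(connect_homo (f := psi) (s := avoid x y)).
by rewrite !phiK; apply=> c d; rewrite /avoid /= adjpsi -!notinE !psiK.
Qed.

Lemma separatingC x y : separating x y -> separating y x.
Proof.
move=> [a [b [ax bx nab]]]; exists a, b; split.
- by move: ax; rewrite !inE orbC.
- by move: bx; rewrite !inE orbC.
by rewrite -(eq_connect (avoidC x y)).
Qed.

Lemma separating_edges x y x' y' :
  adj x y -> separating x y -> adj x' y' -> separating x' y'.
Proof.
move=> xy sep /(iso_invariant_edges separating_iso xy sep) [] //.
exact: separatingC.
Qed.

(** * Leaves and stars *)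

Lemma star_of_leaves c :
  (forall t, t != c -> adj c t /\ leaf_at t c) -> is_star G.
Proof.
move=> Hc; pose S : finType := {t : G | t != c}; exists #|S|.
pose f (t : G) : complete_bipartite 1 #|S| :=
  if (insub t : option S) is Some s then inr (enum_rank s) else inl ord0.
pose g (t : complete_bipartite 1 #|S|) : G :=
  if t is inr i then val (enum_val i) else c.
exists f; split.
  exists g => [t|[i|i]]; rewrite /f /g.
  - by case: insubP => [s _ <-|/negPn/eqP->] //; rewrite enum_rankK.
  - by rewrite insubF ?eqxx // ord1.
  - by rewrite valK enum_valK.
move=> x y; rewrite /f; case: insubP => [s xc _|/negPn/eqP->];
  case: insubP => [s' yc _|/negPn/eqP->] /=.
- apply/esym/negP => /(Hc x xc).2 e; by rewrite e eqxx in yc.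
- by rewrite adj_sym (Hc x xc).1.
- by rewrite (Hc y yc).1.
- by rewrite adj_irr.
Qed.

Lemma leaf_star v a : leaf_at v a -> is_star G.
Proof.
(* If [v] is not adjacent to [a], it is isolated, and connectedness makes [G] the single vertex
   [K_{1,0}]. *)
move=> lv; case va: (adj v a); last first.
  apply: (@star_of_leaves v) => t /negP[]; apply/eqP; move: t.
  apply: (@connected_ind _ v) => // u w -> vw.
  by move: (vw); rewrite (lv _ vw) va.
have av : adj a v by rewrite adj_sym.
(* By edge-transitivity the edge from [a] to [t] has a leaf end; if that end is [a], then
   [t = v]. *)
have step t s : adj a t -> adj t s -> s = a.
  move=> at_ ts; have [lf|lf] := iso_invariant_edges leaf_at_iso va lv at_.
    by apply: lv; rewrite (lf _ av).
  exact: lf.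
have nb t : t = a \/ adj a t.
  move: t; apply: (@connected_ind _ a); first by left.
  by move=> u w [-> | au] uw; [right | left; apply: step uw].
apply: (@star_of_leaves a) => t /eqP ta; have [//|at_] := nb t.
by split=> // s; apply: step.
Qed.

Hypothesis not_star : ~ is_star G.

Lemma other_neighbour v a : exists2 w, adj v w & w != a.
Proof.
case: (pickP (fun w => adj v w && (w != a))) => [w /andP[]|none].
  by exists w.
case: not_star; apply: (@leaf_star v a) => z vz.
by move: (none z); rewrite vz => /negbFE/eqP.
Qed.

(** * Components after deleting the ends of an edge *)

Definition component x y w := [set v | connect (avoid x y) w v].

Lemma component_avoid x y w v :
  w \notin [:: x; y] -> v \in component x y w -> v \notin [:: x; y].
Proof.
move=> wxy; rewrite inE => /connectP[p + ->].
by elim: p w wxy => //= z p IH w wxy /andP[/and3P[_ _ zxy]]; apply: IH.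
Qed.

Lemma component_step x y w u v : w \notin [:: x; y] ->
  u \in component x y w -> adj u v -> v \notin [:: x; y] ->
  v \in component x y w.
Proof.
move=> wxy uC uv vxy; rewrite inE.
have uxy := component_avoid wxy uC; rewrite inE in uC.
by apply: connect_trans uC (connect1 _); rewrite /avoid /= uv uxy.
Qed.

(** Vertices outside the component [C] all reach [x] avoiding [u] and [v]. One of two separated
    vertices does not reach [x], so its component lies in [C], and it misses [u]. *)
Lemma component_shrinks x y w u v :
  adj x y -> w \notin [:: x; y] -> separating u v ->
  u \in component x y w -> v \in component x y w ->
  exists2 a, a \notin [:: u; v] & #|component u v a| < #|component x y w|.
Proof.
move=> xy wxy [a [b [auv buv nab]]] uC vC.
set C := component x y w in uC vC *.
have outC t : t \notin C -> t \notin [:: u; v].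
  by apply: contra; rewrite in_cons mem_seq1 => /orP[]/eqP->.
have xC : x \notin C.
  by apply/negP => /(component_avoid wxy); rewrite !inE eqxx.
have yC : y \notin C.
  by apply/negP => /(component_avoid wxy); rewrite !inE eqxx orbT.
(* A walk leaves [C] only through [x] or [y], and these are adjacent. *)
have toX t : t \notin C -> connect (avoid u v) t x.
  move: t; apply: (@connected_ind _ x) => [|s t IH st tC]; first by [].
  case tx: (t == x); first by rewrite (eqP tx).
  case ty: (t == y).
    by rewrite (eqP ty) connect1 //= /avoid /= adj_sym xy !outC.
  have sC : s \notin C.
    apply: contra tC => sC; apply: component_step wxy sC st _.
    by rewrite !inE tx ty.
  apply: connect_trans (IH sC); apply: connect1.
  by rewrite /avoid /= adj_sym st !outC.
have csym := sym_connect_sym (avoid_sym u v).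
have [c cuv ncx] : exists2 c, c \notin [:: u; v] & ~~ connect (avoid u v) c x.
  case ax: (connect (avoid u v) a x); last by exists a; rewrite ?ax.
  exists b => //; apply: contra nab => bx.
  by apply: connect_trans ax _; rewrite csym.
exists c => //; apply: proper_card; apply/properP; split.
  apply/subsetP => t; rewrite inE => ct; apply: contraR ncx => /toX.
  exact: connect_trans ct.
exists u => //; apply/negP => /(component_avoid cuv).
by rewrite !inE eqxx.
Qed.

Lemma edge_not_separating x y : adj x y -> ~ separating x y.
Proof.
move=> xy sep.
have sepE u v : adj u v -> separating u v by apply: separating_edges xy sep.
have [a0 [_ [a0xy _ _]]] := sep.
have [n] := ubnP #|component x y a0|.
elim: n => // n IH in x y xy sep a0 a0xy *; rewrite ltnS => szn.
have noedge u v :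
    u \in component x y a0 -> v \in component x y a0 -> ~~ adj u v.
  move=> uC vC; apply/negP => uv.
  have [a auv lt] := component_shrinks xy a0xy (sepE _ _ uv) uC vC.
  exact: IH u v uv (sepE _ _ uv) a auv (leq_trans lt szn).
have a0C : a0 \in component x y a0 by rewrite inE.
(* The component has no edge, so it is just [a0]; minimum degree 2 then makes both [x] and [y]
   neighbours. *)
have nb z : adj a0 z -> z \in [:: x; y].
  move=> a0z; apply: contraLR a0z => zxy; apply/negP => a0z.
  by have /negP[] := noedge _ _ a0C (component_step a0xy a0C a0z zxy).
have a0x : adj a0 x.
  have [z a0z zy] := other_neighbour a0 y.
  by have := nb _ a0z; rewrite !inE (negPf zy) orbF => /eqP <-.
have a0y : adj a0 y.
  have [z a0z zx] := other_neighbour a0 x.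
  by have := nb _ a0z; rewrite !inE (negPf zx) /= => /eqP <-.
have d2 : degree_le2 a0.
  by exists x, y => z /nb; rewrite !inE => /orP[]/eqP; [left|right].
(* In a triangle [a0 s t] where [a0] and [s] have no further neighbours, all remaining vertices
   reach [t] avoiding [a0] and [s], so the edge [a0 s] cannot separate. *)
have key s t : adj a0 s -> adj a0 t -> adj s t ->
    (forall z, adj a0 z -> z = s \/ z = t) -> degree_le2 s -> False.
  move=> a0s a0t st nst [c [d cd]].
  have neq u v : adj u v -> u != v.
    by apply: contraTneq => ->; rewrite adj_irr.
  have ns z : adj s z -> z = a0 \/ z = t.
    have sa0 : adj s a0 by rewrite adj_sym.
    move=> /cd zcd; have := neq _ _ a0t.
    have [->|->] := cd _ sa0; have [->|->] := cd _ st; rewrite ?eqxx // => _;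
      case: zcd; by [left|right].
  have [a [b [aS bS /negP[]]]] := sepE _ _ a0s.
  have toT z : z \notin [:: a0; s] -> connect (avoid a0 s) z t.
    move: z; apply: (@connected_ind _ t) => // u v IHu uv vS.
    case: (eqVneq v t) => [->//|vt].
    have uS : u \notin [:: a0; s].
      move: vS; rewrite !inE !negb_or => /andP[va vs].
      apply/andP; split; apply/eqP => e; move: uv; rewrite e.
        by case/nst => e'; [move: vs | move: vt]; rewrite e' eqxx.
      by case/ns => e'; [move: va | move: vt]; rewrite e' eqxx.
    apply: connect_trans (IHu uS); apply: connect1.
    by rewrite /avoid /= adj_sym uv vS uS.
  apply: connect_trans (toT a aS) _.
  by rewrite (sym_connect_sym (avoid_sym a0 s)) toT.
have nxy z : adj a0 z -> z = x \/ z = y.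
  by move=> /nb; rewrite !inE => /orP[]/eqP; [left|right].
have [dx|dy] := iso_invariant_edges degree_le2_iso a0x d2 xy.
  exact: (key x y).
apply: (key y x) => //; first by rewrite adj_sym.
by move=> z /nxy[]; [right|left].
Qed.

(** * Closing paths of length at most 3 *)

Lemma close_path3 w x y z : is_path_of_length 3 [:: w; x; y; z] ->
  closes_to_cycle [:: w; x; y; z].
Proof.
move=> [_ /= un /and4P[wx xy yz _]].
have wxy : w \notin [:: x; y].
  by move: un; rewrite !inE => /and4P[]; rewrite !negb_or => /and3P[-> ->].
have zxy : z \notin [:: x; y].
  move: un; rewrite !inE !negb_or => /and4P[_ /andP[_ xz] yz' _].
  by rewrite eq_sym xz eq_sym yz'.
have zw : connect (avoid x y) z w.
  by apply: contraT => nzw; case: (edge_not_separating xy); exists z, w.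
have {zw} [q0 pth0 lst0] := connectP zw.
(* The return path from [z] to [w] is made simple, so that with [x] and [y] it forms a cycle. *)
case/shortenP: pth0 lst0 => q pth unq _ lst.
have qxy t : t \in z :: q -> t \notin [:: x; y].
  move=> tq; apply: component_avoid zxy _; rewrite inE.
  exact: path_connect pth _ tq.
have pthadj : path (@adj G) z q.
  by apply: sub_path pth => a b /and3P[].
have wq : w \in z :: q by rewrite lst mem_last.
have inq : w \in q.
  move: wq; rewrite inE => /orP[/eqP e|//].
  by move: un; rewrite e !inE eqxx !orbT.
exists [:: x, y, z & q]; split.
- split.
  + by case: (q) inq.
  + rewrite /= -/(uniq (z :: q)) unq andbT inE negb_or.
    apply/andP; split; last first.
      by apply/negP => /qxy; rewrite !inE eqxx orbT.
    apply/andP; split; last first.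
      by apply/negP => /qxy; rewrite !inE eqxx.
    by apply: contraTneq xy => ->; rewrite adj_irr.
  + by rewrite /= xy yz rcons_path pthadj -lst.
- move=> t; rewrite !inE => /or4P[]/eqP->; rewrite ?eqxx ?orbT //.
  by rewrite inq !orbT.
- move=> e; rewrite /= !inE => /or3P[]/eqP->; rewrite ?eqxx ?orbT //.
  (* As [w] ends [q], this is the edge that closes the cycle at [x]. *)
  suff -> : [set w; x] \in pairmap (fun y z => [set y; z]) z (rcons q x).
    by rewrite !orbT.
  by rewrite -cats1 pairmap_cat mem_cat -lst /= inE eqxx orbT.
Qed.

(** A further neighbour [w] of [z] either equals [x], giving a triangle, or extends the path to
    length 3. *)
Lemma close_path2 x y z : is_path_of_length 2 [:: x; y; z] ->
  closes_to_cycle [:: x; y; z].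
Proof.
move=> [_ un pth]; have [w zw wy] := other_neighbour z y.
move: (un) (pth) => /= /and3P[+ yz _] /and3P[xy yzadj _].
rewrite !inE negb_or => /andP[nxy nxz].
have zw' : z != w by apply: contraTneq zw => ->; rewrite adj_irr.
case: (eqVneq w x) => [wx|wx].
  exists [:: x; y; z]; split=> //; last first.
    by move=> e; rewrite /= !inE => /orP[]/eqP->; rewrite eqxx ?orbT.
  by split=> //=; rewrite xy yzadj -wx zw.
have [] := @close_path3 x y z w.
  split=> //=; last by rewrite xy yzadj zw.
  rewrite !inE !negb_or nxy nxz (eq_sym x w) wx (eq_sym y w) wy zw'.
  by rewrite inE in yz; rewrite yz.
move=> c [cyc sub sube]; exists c; split=> // t tp.
  by apply: sub; move: tp; rewrite !inE => /or3P[]->; rewrite ?orbT.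
by apply: sube; move: tp; rewrite /= !inE => /orP[]->; rewrite ?orbT.
Qed.

Lemma close_path1 x y : adj x y -> closes_to_cycle [:: x; y].
Proof.
move=> xy; have [z yz zx] := other_neighbour y x.
have neq u v : adj u v -> u != v.
  by apply: contraTneq => ->; rewrite adj_irr.
have [] := @close_path2 x y z.
  split=> //=; last by rewrite xy yz.
  by rewrite !inE negb_or (neq _ _ xy) (neq _ _ yz) eq_sym zx.
move=> c [cyc sub sube]; exists c; split=> // t tp.
  by apply: sub; move: tp; rewrite !inE => /orP[]->; rewrite ?orbT.
by apply: sube; move: tp; rewrite /= !inE => ->.
Qed.

Lemma close_short_path (l : nat) p :
  l <= 3 -> is_path_of_length l p -> closes_to_cycle p.
Proof.
case: p => [|w [|x [|y [|z [|? p]]]]] l3 lp; case: (lp) => //= szp un pth.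
- have [x wx _] := other_neighbour w w.
  have [c [cyc sub sube]] := close_path1 wx.
  exists c; split=> // t; rewrite inE => /eqP->.
  by apply: sub; rewrite !inE eqxx.
- by apply: close_path1; case/andP: pth.
- exact: close_path2.
- exact: close_path3.
- by case: szp l3 => <-.
Qed.

End EdgeTransitive.

(** * Edges of a cycle *)

Lemma fpath_edges (G : sgraph) (f : G -> G) x s e :
  fpath f x s -> e \in path_edges (x :: s) -> exists u, e = [set u; f u].
Proof.
elim: s x => //= z s IH x /andP[/eqP fx pth].
by rewrite inE => /orP[/eqP->|]; [exists x; rewrite fx | apply: IH].
Qed.

Section CycleEdges.
Variables (G : sgraph) (c : seq G).
Hypothesis cyc : is_cycle c.

Lemma cycle_edges_next e :
  e \in cycle_edges c -> exists u, e = [set u; next c u].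
Proof.
have [_ unc _] := cyc; have := cycle_next unc.
case: c => // x q; exact: fpath_edges.
Qed.

Lemma cycle_edge_neighbour u v : [set u; v] \in cycle_edges c ->
  v = next c u \/ v = prev c u.
Proof.
have [_ unc _] := cyc.
case/cycle_edges_next => w /set2_eq [[-> ->]|[-> ->]]; first by left.
by right; rewrite prev_next.
Qed.

(** Rotated to start at [u], the cycle has length at least 3: its second vertex is the successor and
    its last one the predecessor. *)
Lemma next_neq_prev u : u \in c -> next c u != prev c u.
Proof.
have [szc unc _] := cyc; case/rot_to => i q e.
rewrite -(next_rot i unc) -(prev_rot i unc) e.
move: szc unc; rewrite -(size_rot i) -(rot_uniq i) e.
case: q {e} => [|a [|b q]] // _ /andP[uq /andP[aq _]].
rewrite prev_nth mem_head memNindex // next_nth mem_head /= eqxx /=.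
rewrite -[size q]/((size (b :: q)).-1) nth_last /=.
by apply: contraNneq aq => ->; apply: mem_last.
Qed.

(** Three distinct vertices would all lie among [next c u] and [prev c u]. *)
Lemma cycle_no_three_neighbours u a b d : uniq [:: a; b; d] ->
  [set u; a] \in cycle_edges c -> [set u; b] \in cycle_edges c ->
  d \in c -> (u = next c d \/ u = prev c d) -> False.
Proof.
have [_ unc _] := cyc.
move=> un /cycle_edge_neighbour ha /cycle_edge_neighbour hb dc hd.
have {}hd : d = next c u \/ d = prev c u.
  by case: hd => ->; [right; rewrite prev_next | left; rewrite next_prev].
by move: un; case: ha => ->; case: hb => ->; case: hd => ->;
  rewrite /= !inE !eqxx ?orbT ?andbF.
Qed.

End CycleEdges.

(** * The subdivided double of a complete graph *)

Section SubdividedDouble.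
Variable n : nat.

(* The arcs (i, j) and (j, i) are the midpoints of the two parallel edges
   between i and j. *)
Definition arc : finType := {a : 'I_n * 'I_n | a.1 != a.2}.

Definition sub_adj : rel ('I_n + arc) := fun u v =>
  match u, v with
  | inl i, inr a | inr a, inl i => (i == (val a).1) || (i == (val a).2)
  | _, _ => false
  end.

Lemma sub_adj_sym : symmetric sub_adj.
Proof. by case=> ? [?|?]. Qed.

Lemma sub_adj_irr : irreflexive sub_adj.
Proof. by case. Qed.

Definition subdivided_double : sgraph := SGraph sub_adj_sym sub_adj_irr.

(** Midpoints are the off-diagonal pairs, and the [n] original vertices match the diagonal ones. *)
Lemma card_subdivided_double : #|subdivided_double| = n * n.
Proof.
rewrite card_sum card_ord card_sig.
rewrite -[in RHS](card_ord n) -card_prod.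
rewrite -(cardC (fun a : 'I_n * 'I_n => a.1 == a.2)).
congr (_ + _).
rewrite -[LHS](card_ord n) -(card_codom (f := fun i : 'I_n => (i, i))).
  by apply: eq_card => -[i j]; apply/codomP/eqP => /= [[k [-> ->]] //|->];
    exists j.
by move=> i j [].
Qed.

Lemma connected_subdivided_double : 0 < n -> connected subdivided_double.
Proof.
move=> n0; split; first by rewrite card_subdivided_double muln_gt0 n0.
have csym := sym_connect_sym sub_adj_sym.
have vv i j : connect sub_adj (inl i) (inl j).
  case: (eqVneq i j) => [->//|ij].
  apply: (@connect_trans _ _ (inr (exist _ (i, j) ij))); apply: connect1 => /=.
    by rewrite eqxx.
  by rewrite eqxx orbT.
have tov u : exists i, connect sub_adj u (inl i).
  case: u => [i|a]; first by exists i.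
  by exists (val a).1; apply: connect1; rewrite /= eqxx.
move=> u v; have [i ui] := tov u; have [j vj] := tov v.
apply: connect_trans ui _; apply: connect_trans (vv i j) _.
by rewrite csym.
Qed.

Section Relabel.
Variables (s : {perm 'I_n}) (flip : bool).

(** Permutations alone preserve which coordinate of an arc an edge meets; [flip] exchanges parallel
    midpoints and so the coordinates. *)
Definition relabel_pair (a : 'I_n * 'I_n) :=
  if flip then (s a.2, s a.1) else (s a.1, s a.2).

Lemma relabel_pairP (a : arc) :
  (relabel_pair (val a)).1 != (relabel_pair (val a)).2.
Proof.
have := valP a; rewrite /relabel_pair; case: flip => /=;
  by rewrite (inj_eq perm_inj) // eq_sym.
Qed.

Definition relabel (u : subdivided_double) : subdivided_double :=
  match u with
  | inl i => inl (s i)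
  | inr a => inr (exist _ (relabel_pair (val a)) (relabel_pairP a))
  end.

Lemma relabel_iso : graph_iso relabel.
Proof.
split.
  apply: injF_bij => -[i|[[i j] ij]] [i'|[[i' j'] ij']] //= [].
    by move=> /perm_inj ->.
  rewrite /relabel_pair /=; case: flip => -[/perm_inj e1 /perm_inj e2];
    by congr inr; apply: val_inj; rewrite /= e1 e2.
case=> [i|a] [j|b] //=; rewrite /relabel_pair; case: flip;
  by rewrite /= !(inj_eq perm_inj) // orbC.
Qed.

End Relabel.

(** One transposition moves [i] to [i']; a second, fixing [i'], corrects the image of [j]. *)
Lemma perm_2transitive (i j i' j' : 'I_n) : i != j -> i' != j' ->
  exists2 s : {perm 'I_n}, s i = i' & s j = j'.
Proof.
move=> ij ij'; exists (tperm i i' * tperm (tperm i i' j) j')%g.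
  have h : tperm i i' j != i'.
    by rewrite -[X in _ != X](tpermL i i') (inj_eq perm_inj) eq_sym.
  by rewrite permM tpermL (tpermD h) // eq_sym.
by rewrite permM tpermL.
Qed.

Lemma edges_arc (e : {set subdivided_double}) :
  e \in edges subdivided_double ->
  exists (b : bool) (a : arc),
    e = [set inl (if b then (val a).2 else (val a).1); inr a].
Proof.
have key i (a : arc) : (i == (val a).1) || (i == (val a).2) ->
    exists (b : bool), i = (if b then (val a).2 else (val a).1).
  by case/orP => /eqP ->; [exists false | exists true].
case/imset2P => -[i|a] [j|a'] _; rewrite !inE //= => /key [b ->] ->.
  by exists b, a'.
by exists b, a; rewrite setUC.
Qed.

Lemma edge_transitive_subdivided_double : edge_transitive subdivided_double.
Proof.
move=> e f /edges_arc [b [[[i j] ij] ->]] /edges_arc [b' [[[i' j'] ij'] ->]].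
rewrite /= in ij ij' *.
have [s si sj] : exists2 s : {perm 'I_n},
    s (if b then j else i) = (if b' then j' else i') &
    s (if b then i else j) = (if b' then i' else j').
  by apply: perm_2transitive; [case: b | case: b'] => //=; rewrite eq_sym.
(* Flip exactly when the two edges meet their arcs at different coordinates. *)
exists (relabel s (b != b')); first exact: relabel_iso.
rewrite imsetU !imset_set1 /= si; congr [set _; inr _].
by apply: val_inj; rewrite /= /relabel_pair /=;
  move: si sj; case: b b' {ij ij'} => -[] /= -> ->.
Qed.

End SubdividedDouble.

(** * A path that does not close *)

Section OpenPath.
Variables (n l : nat).
Hypotheses (l4 : 4 <= l) (ln : l < n).

Local Notation G := (subdivided_double n.+1).

(* The default value [inl _] is only taken when [i] and [j] name the same
   ordinal; [inord] sends numbers above [n] to [0]. *)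
Definition arc_vertex (i j : nat) : G :=
  if insub (inord i, inord j) is Some a then inr a else inl (inord i).

(** The zigzag [0, (0,1), 1, (1,2), 2, ...], with original vertices at even positions. *)
Definition walk (k : nat) : G :=
  if odd k then arc_vertex k./2 k./2.+1 else inl (inord k./2).

Definition open_path : seq G := arc_vertex 1 0 :: mkseq walk l.

Lemma arc_vertexP i j : i <= n -> j <= n -> i != j ->
  exists2 a : arc n.+1, arc_vertex i j = inr a & val a = (inord i, inord j).
Proof.
move=> ilt jlt ij; rewrite /arc_vertex; case: insubP => [a _ va|].
  by exists a.
by rewrite /= -(inj_eq val_inj) /= !inordK // ij.
Qed.

Lemma adj_arc_vertex (k i j : nat) : i <= n -> j <= n -> k <= n -> i != j ->
  adj (inl (inord k) : G) (arc_vertex i j) = (k == i) || (k == j).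
Proof.
move=> ilt jlt klt ij; have [a -> va] := arc_vertexP ilt jlt ij.
by rewrite /= va /= -!(inj_eq val_inj) /= !inordK.
Qed.

Lemma walk_adj k : k < l -> adj (walk k) (walk k.+1).
Proof.
move=> kl; have kn : k./2.+1 <= n by move: kl ln; lia.
rewrite /walk oddS -uphalfE uphalf_half; case: (odd k);
  rewrite /negb ?add1n ?add0n.
  by rewrite adj_sym adj_arc_vertex ?eqxx ?orbT ?(ltnW kn) ?neq_ltn ?ltnSn.
by rewrite adj_arc_vertex ?eqxx ?(ltnW kn) ?neq_ltn ?ltnSn.
Qed.

(** A left inverse of [walk], giving its injectivity. *)
Definition walk_index (u : G) : nat :=
  match u with inl i => i.*2 | inr a => ((val a).1 : nat).*2.+1 end.

Lemma walkK k : k < l -> walk_index (walk k) = k.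
Proof.
move=> kl; have kn : k./2.+1 <= n by move: kl ln; lia.
rewrite /walk; case ok: (odd k); last first.
  by rewrite /= inordK; move: ok kn; lia.
have [] := @arc_vertexP k./2 k./2.+1; rewrite ?(ltnW kn) // ?neq_ltn ?ltnSn //.
by move=> a -> /= -> /=; rewrite inordK; move: ok kn; lia.
Qed.

(** Arcs on the walk have positive second coordinate. *)
Lemma open_path_head : arc_vertex 1 0 \notin mkseq walk l.
Proof.
apply/negP => /mapP[k]; rewrite mem_iota add0n => /andP[_ kl].
have [a -> va] : exists2 a : arc n.+1, arc_vertex 1 0 = inr a &
    val a = (inord 1, inord 0) by apply: arc_vertexP => //; move: l4 ln; lia.
rewrite /walk; case: (odd k) => //.
have [||//|b -> vb [ab]] := @arc_vertexP k./2 k./2.+1; try by move: kl ln; lia.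
move: vb; rewrite -ab va => -[_ /(congr1 val)] /=.
by rewrite !inordK //; move: kl ln; lia.
Qed.

Lemma uniq_open_path : uniq open_path.
Proof.
rewrite /= open_path_head; apply/mkseq_uniqP => i j il jl e.
by rewrite -(walkK il) e walkK.
Qed.

Lemma open_path_is_path : is_path_of_length l open_path.
Proof.
split; [by rewrite /= size_mkseq | exact: uniq_open_path |].
apply/(sortedP (walk 0)) => -[|i]; rewrite [size _]/= size_mkseq !ltnS => il.
  rewrite [nth _ _ 0]/= [nth _ _ 1]/= nth_mkseq // /walk adj_sym
    adj_arc_vertex //.
  by move: l4 ln; lia.
rewrite [nth _ _ i.+1]/= [nth _ _ i.+2]/= !nth_mkseq ?(ltnW il) //.
exact: walk_adj (ltnW il).
Qed.

Lemma arc_vertex10_neighbour (u : G) : adj (arc_vertex 1 0) u ->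
  u = walk 2 \/ u = walk 0.
Proof.
have [a -> va] : exists2 a : arc n.+1, arc_vertex 1 0 = inr a &
    val a = (inord 1, inord 0) by apply: arc_vertexP => //; move: l4 ln; lia.
case: u => //= i; rewrite va /= => /orP[]/eqP->; by [left|right].
Qed.

Lemma open_path_not_closed : ~ closes_to_cycle open_path.
Proof.
move=> [c [cyc subv sube]]; have [_ unc adjc] := cyc.
(* Length at least 4 puts [walk 3] on the path. *)
have [l' el] : exists l', l = l'.+4 by exists (l - 4); move: l4; lia.
pose d : G := arc_vertex 1 0.
have dc : d \in c by apply: subv; rewrite mem_head.
(* The head has only the neighbours [walk 0] and [walk 2], so the cycle uses both. *)
have h : walk 2 = next c d \/ walk 2 = prev c d.
  have nx := arc_vertex10_neighbour (next_cycle adjc dc).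
  have pv : prev c d = walk 2 \/ prev c d = walk 0.
    by apply: arc_vertex10_neighbour; rewrite adj_sym prev_cycle.
  have := next_neq_prev cyc dc.
  by case: nx => ->; [left | case: pv => ->; [right | rewrite eqxx]].
apply: (cycle_no_three_neighbours cyc (a := walk 1) (b := walk 3)) dc h.
- have wd k : k < l -> walk k != d.
    move=> kl; apply: contraNneq open_path_head => e.
    by rewrite -/d -e map_f // mem_iota.
  have w13 : walk 1 != walk 3.
    by apply/eqP => /(congr1 walk_index); rewrite !walkK; move: l4; lia.
  by rewrite /= !inE negb_or w13 !wd; move: l4; lia.
- rewrite setUC; apply: sube.
  by rewrite /open_path el /mkseq /= !inE eqxx !orbT.
- by apply: sube; rewrite /open_path el /mkseq /= !inE eqxx !orbT.
Qed.

End OpenPath.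

Theorem theorem1p8 :
  (forall G : sgraph, connected G -> edge_transitive G -> ~ is_star G ->
     forall (l : nat) (p : seq G),
       l <= 3 -> is_path_of_length l p -> closes_to_cycle p)
  /\
  (forall l : nat, 4 <= l ->
     infinitely_many_graphs (fun G : sgraph =>
       [/\ connected G, edge_transitive G
         & exists p : seq G, is_path_of_length l p /\ ~ closes_to_cycle p])).
Proof.
split=> [|l l4]; first exact: close_short_path.
(* The orders are distinct squares, so no two members are isomorphic. *)
exists (fun i => subdivided_double (l.+1 + i).+1).
split=> [i|i j ij [f [bij _]]].
  have ln : l < l.+1 + i by rewrite leq_addr.
  split; [exact: connected_subdivided_double
         | exact: edge_transitive_subdivided_double |].
  by exists (open_path _ l); split;
    [exact: open_path_is_path | exact: open_path_not_closed].
have := bij_eq_card bij; rewrite !card_subdivided_double => e.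
by apply: ij; nia.
Qed.
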